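(* Let $G$ be a finite group, $H$ a normal subgroup of $G$ and $K$ a subgroup of $H$ which contains $[G,H]$. If $H$ is a perfect code of $G$, then $K$ is a perfect code of $G$ provided that one of the following conditions holds: (a) $[G,H]$ is a perfect code of $G$ and $K$ is a perfect code of $H$; (b) $K$ is of odd index in $H$.
   Context: For a finite group $G$ with identity $1$ and a subset $S\subseteq G\setminus\{1\}$ with $S^{-1}=S$ (possibly $S=\emptyset$), the Cayley graph $\mathrm{Cay}(G,S)$ has vertex set $G$, with $x,y$ adjacent if and only if $yx^{-1}\in S$. A perfect code in a graph $\Gamma$ with vertex set $V$ is a subset $C\subseteq V$ such that no two vertices of $C$ are adjacent and every vertex in $V\setminus C$ is adjacent to exactly one vertex in $C$. A subset (in particular a subgroup) $C$ of $G$ is called a perfect code of $G$ if there exists such an $S$ for which $C$ is a perfect code in $\mathrm{Cay}(G,S)$. For subsets $A,B$ of $G$, $[A,B]$ denotes the subgroup of $G$ generated by all commutators $[a,b]=a^{-1}b^{-1}ab$ with $a\in A$ and $b\in B$. *)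

(* Defs.v *)
From mathcomp Require Import all_boot all_fingroup.

Set Implicit Arguments.
Unset Strict Implicit.
Unset Printing Implicit Defensive.

Local Open Scope group_scope.

Definition cayley_adj (gT : finGroupType) (S : {set gT}) : rel gT :=
  fun x y => y * x^-1 \in S.

(* Perfect codes of the graph with vertex set V and adjacency relation e
   (restricted to V). *)
Definition graph_perfect_code (T : finType) (V : {set T}) (e : rel T)
    (C : {set T}) : Prop :=
  [/\ C \subset V,
      {in C &, forall x y, ~~ e x y}
    & {in V :\: C, forall v, #|[set c in C | e v c]| = 1%N}].

(* The vertex set of the Cayley graph is the group G, not the ambient type gT,
   so that "perfect code of G" and "perfect code of a subgroup H of G" are
   instances of the same definition. *)
Definition perfect_code (gT : finGroupType) (G : {group gT})
    (C : {set gT}) : Prop :=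
  exists S : {set gT},
    [/\ S \subset G^#, S^-1 = S & graph_perfect_code G (cayley_adj S) C].

(* Main.v *)
Require Import Defs.
From mathcomp Require Import all_boot all_fingroup.
From mathcomp Require Import cyclic commutator.

(** A normal subgroup N of G is a perfect code exactly when it has the
    square-root property [has_involutory_lifts G N]: every g in G whose square
    lies in N can be corrected by an element of N to an element of square 1.
    The reason is that adding 1 to a connection set S of a perfect code N turns
    it into an inverse-closed transversal of N.  Inversion permutes the cosets
    of N.  The cosets exchanged in pairs impose no condition, and a coset fixed
    by inversion needs a representative equal to its own inverse
    (perfect_code_involutory_lifts, involutory_lifts_perfect_code).

    In the theorem K contains [G, H], so H / K is central in G / K and all the
    subgroups concerned are normal in G.  Let g be in G with g ^+ 2 in K.
    Since H is a perfect code, g = t * h with t ^+ 2 = 1 and h in H, and modulo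
    [G, H] the elements t and h commute, so h ^+ 2 is in K.
    If #|H : K| is odd, then h itself is in K, so that t = g * h^-1 corrects g.
    If K is a perfect code of H, some k in K makes h * k of square 1; then
    g * k = t * (h * k) is a product of two elements of square 1 that commute
    modulo [G, H], so its square is in [G, H], and a last correction by an
    element of [G, H] is available when [G, H] is a perfect code of G. *)

Set Implicit Arguments.
Unset Strict Implicit.
Unset Printing Implicit Defensive.

Local Open Scope group_scope.

Definition has_involutory_lifts (gT : finGroupType) (G N : {set gT}) : Prop :=
  {in G, forall g, g ^+ 2 \in N -> exists2 n, n \in N & (g * n) ^+ 2 = 1}.

(** If c is the neighbour of g in N, reached by s = c * g^-1, then s^-1 also
    leads from g into N, because g ^+ 2 is in N.  Uniqueness of the neighbour
    forces s = s^-1. *)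
Lemma perfect_code_involutory_lifts (gT : finGroupType) (G N : {group gT}) :
  N <| G -> perfect_code G N -> has_involutory_lifts G N.
Proof.
move=> nNG [S [_ SV [_ _ uniqN]]] g Gg g2N.
have [Ng | notNg] := boolP (g \in N).
  by exists g^-1; rewrite ?groupV // mulgV expg1n.
have /uniqN/eqP/cards1P[c defc] : g \in G :\: N by rewrite inE notNg.
have: c \in [set c in N | cayley_adj S g c] by rewrite defc inE.
rewrite inE /cayley_adj => /andP[Nc Sc].
have: g * c^-1 * g \in [set c in N | cayley_adj S g c].
  rewrite inE /cayley_adj mulgK -SV inE invMg invgK Sc andbT.
  have ->: g * c^-1 * g = c^-1 ^ g^-1 * g ^+ 2.
    by rewrite /conjg invgK expg2 !mulgA mulgKV.
  by rewrite groupM // memJ_norm ?groupV // (subsetP (normal_norm nNG)).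
rewrite defc inE => /eqP eq_c.
by exists c^-1; rewrite ?groupV // expg2 mulgA eq_c mulgV.
Qed.

(** Preferring elements of square 1 matters for a coset that is its own
    inverse: there the representative must be equal to its inverse. *)
Definition involutory_repr (gT : finGroupType) (X : {set gT}) : gT :=
  odflt (repr X) [pick x in X | x ^+ 2 == 1].

Lemma mem_involutory_repr (gT : finGroupType) (X : {set gT}) (x : gT) :
  x \in X -> involutory_repr X \in X.
Proof.
move=> Xx; rewrite /involutory_repr.
by case: pickP => [y /andP[] // | _]; apply: mem_repr Xx.
Qed.

Lemma involutory_repr_sq (gT : finGroupType) (X : {set gT}) (x : gT) :
  x \in X -> x ^+ 2 = 1 -> involutory_repr X ^+ 2 = 1.
Proof.
move=> Xx x2; rewrite /involutory_repr.
case: pickP => [y /andP[_ /eqP] // | /(_ x)].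
by rewrite Xx x2 eqxx.
Qed.

(** The connection set consists of one element and its inverse for each pair
    of mutually inverse nontrivial cosets.  The chosen element depends only on
    the union [coset_pair N x] of the pair, which makes the connection set
    inverse-closed. *)
Definition coset_pair (gT : finGroupType) (N : {set gT}) (x : gT) : {set gT} :=
  (N :* x) :|: (N :* x^-1).

Lemma coset_pairV (gT : finGroupType) (N : {set gT}) (x : gT) :
  coset_pair N x^-1 = coset_pair N x.
Proof. by rewrite /coset_pair invgK setUC. Qed.

Lemma rcosetV_normal (gT : finGroupType) (G N : {group gT}) (x y : gT) :
  N <| G -> x \in G -> (y^-1 \in N :* x) = (y \in N :* x^-1).
Proof.
move=> nNG Gx; rewrite -mem_invg invg_rcoset norm_rlcoset //.
by rewrite groupV (subsetP (normal_norm nNG)).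
Qed.

Lemma coset_pair_eq (gT : finGroupType) (G N : {group gT}) (x y : gT) :
  N <| G -> x \in G -> y \in N :* x -> coset_pair N y = coset_pair N x.
Proof.
move=> nNG Gx Nxy; rewrite /coset_pair (rcoset_eqP Nxy).
suff /rcoset_eqP-> : y^-1 \in N :* x^-1 by [].
by rewrite (rcosetV_normal _ nNG) ?groupV // invgK.
Qed.

Lemma involutory_lifts_perfect_code (gT : finGroupType) (G N : {group gT}) :
  N <| G -> has_involutory_lifts G N -> perfect_code G N.
Proof.
move=> nNG liftN; have sNG := normal_sub nNG.
pose p x := involutory_repr (coset_pair N x).
have pV x : p x^-1 = p x by rewrite /p coset_pairV.
exists [set x in G :\: N | (x == p x) || (x == (p x)^-1)]; split.
- apply/subsetP=> x; rewrite !inE => /andP[/andP[notNx ->] _].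
  by rewrite andbT; apply: contraNneq notNx => ->.
- apply/setP=> x; rewrite !inE pV !groupV; congr (_ && _).
  by rewrite (inj_eq invg_inj) -(inj_eq invg_inj x^-1) invgK orbC.
split=> // [x y Nx Ny | v /setDP[Gv notNv]].
  by rewrite /cayley_adj !inE groupM ?groupV.
have p_pair : p v \in coset_pair N v.
  by apply: (@mem_involutory_repr _ _ v); rewrite inE rcoset_refl.
(* s is the one of p v and (p v)^-1 that lies in the coset of v^-1. *)
have [s Nvs defp] : exists2 s, s \in N :* v^-1 & p v = s \/ p v = s^-1.
  move: p_pair; rewrite inE => /orP[pNv | pNv]; last by exists (p v); [|left].
  exists (p v)^-1; last by right; rewrite invgK.
  by rewrite -(rcosetV_normal _ nNG) ?invgK.
(* Both lie there only if that coset is its own inverse, and then the choice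
   of p makes s its own inverse. *)
have sVs : s^-1 \in N :* v^-1 -> s^-1 = s.
  move=> NvsV; have v2N : v ^+ 2 \in N.
    have: v \in N :* v^-1.
      rewrite -(rcoset_eqP NvsV) rcoset_sym.
      by rewrite (rcosetV_normal _ nNG).
    by rewrite mem_rcoset invgK.
  have [n Nn vn2] := liftN v Gv v2N.
  have vn_pair : v * n \in coset_pair N v.
    rewrite inE norm_rlcoset ?(subsetP (normal_norm nNG)) //.
    by rewrite mem_lcoset mulKg Nn.
  have: p v ^+ 2 = 1 by apply: involutory_repr_sq vn_pair vn2.
  have inv1 (y : gT) : y ^+ 2 = 1 -> y^-1 = y.
    by rewrite expg2 => /eqP; rewrite -eq_invg_mul => /eqP.
  case: defp => -> /inv1 //; by rewrite invgK => <-.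
apply/eqP/cards1P; exists (s * v); apply/setP=> c; rewrite !inE /cayley_adj.
have Nsv : s * v \in N by rewrite mem_rcoset invgK in Nvs.
apply/andP/eqP => [[Nc]|->].
  have Nvc : c * v^-1 \in N :* v^-1 by rewrite mem_rcoset mulgK.
  rewrite inE => /andP[_].
  have -> : p (c * v^-1) = p v.
    by rewrite /p (coset_pair_eq nNG _ Nvc) ?groupV // coset_pairV.
  suff eq_s : c * v^-1 = s \/ c * v^-1 = s^-1 -> c = s * v.
    case: defp => ->; rewrite ?invgK => /orP[] /eqP cv; apply: eq_s;
      by [left | right].
  case=> [<- | cv]; first by rewrite mulgKV.
  by rewrite -sVs -cv // mulgKV.
split=> //; rewrite mulgK !inE.
have -> : p s = p v.
  by rewrite /p (coset_pair_eq nNG _ Nvs) ?groupV // coset_pairV.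
have notNs : s \notin N.
  by apply: contra notNv => Ns; rewrite -(groupMl _ Ns).
have Gs : s \in G.
  by rewrite -(groupMr _ Gv) (subsetP sNG).
by rewrite notNs Gs; case: defp => ->; rewrite ?invgK eqxx ?orbT.
Qed.

Lemma mem_sq_odd_index (gT : finGroupType) (H K : {group gT}) (h : gT) :
  K <| H -> odd #|H : K| -> h \in H -> h ^+ 2 \in K -> h \in K.
Proof.
move=> nKH oddHK Hh h2K.
have Nh : h \in 'N(K) by rewrite (subsetP (normal_norm nKH)).
apply: coset_idr => //; apply/eqP; rewrite -order_eq1 -dvdn1.
have dvd_2 : #[coset K h] %| 2.
  by rewrite order_dvdn -morphX //= coset_id.
have dvd_H : #[coset K h] %| #|H : K|.
  by rewrite -card_quotient ?normal_norm // order_dvdG ?mem_quotient.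
have := coprimen2 #|H : K|; rewrite oddHK /coprime => /eqP <-.
by rewrite dvdn_gcd dvd_H.
Qed.

(** Modulo [G, H] the element t commutes with h, so squaring is
    multiplicative on t * h. *)
Lemma sqM_commg (gT : finGroupType) (G H : {group gT}) (t h : gT) :
  t \in G -> h \in H -> t ^+ 2 = 1 ->
  exists2 r, r \in [~: G, H] & (t * h) ^+ 2 = r * h ^+ 2.
Proof.
move=> Gt Hh t2; exists [~ t, h^-1]; first by rewrite mem_commg ?groupV.
have tV : t^-1 = t by apply/eqP; rewrite eq_invg_mul -expg2 t2.
by rewrite commgEl /conjg invgK tV !expg2 !mulgA mulgKV.
Qed.

Theorem theorem3p8 (gT : finGroupType) (G H K : {group gT})
    (nHG : H <| G) (sKH : K \subset H) (sRK : [~: G, H] \subset K)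
    (pcH : perfect_code G H)
    (hab : (perfect_code G [~: G, H] /\ perfect_code H K) \/ odd #|H : K|) :
  perfect_code G K.
Proof.
have sHG := normal_sub nHG.
have nKG : K <| G.
  rewrite /normal (subset_trans sKH sHG) -commg_subr.
  by rewrite (subset_trans _ sRK) // commgS.
have nKH : K <| H := normalS sKH sHG nKG.
have nRG : [~: G, H]%G <| G.
  by rewrite /normal comm_subG // commg_norml.
apply: involutory_lifts_perfect_code => // g Gg g2K.
have [h Hh gh2] := perfect_code_involutory_lifts nHG pcH Gg
  (subsetP sKH _ g2K).
have Ggh : g * h \in G by rewrite groupM // (subsetP sHG).
have HhV : h^-1 \in H by rewrite groupV.
have h2K : h^-1 ^+ 2 \in K.
  have [r Rr] := sqM_commg Ggh HhV gh2.
  rewrite mulgK => g2; move: g2K.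
  by rewrite g2 groupMl // (subsetP sRK).
case: hab => [[pcR pcK] | oddHK]; last first.
  by exists h => //; rewrite -groupV (@mem_sq_odd_index _ H).
have [k Kk hk2] := perfect_code_involutory_lifts nKH pcK HhV h2K.
have gk2R : (g * k) ^+ 2 \in [~: G, H].
  have Hhk : h^-1 * k \in H by rewrite groupM // (subsetP sKH).
  have [r Rr] := sqM_commg Ggh Hhk gh2.
  by rewrite mulgA mulgK hk2 mulg1 => ->.
have Ggk : g * k \in G by rewrite groupM // (subsetP (normal_sub nKG)).
have [r Rr gkr2] := perfect_code_involutory_lifts nRG pcR Ggk gk2R.
by exists (k * r); rewrite ?mulgA // groupM // (subsetP sRK).
Qed.
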